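(* Let $f:[-1,1]^2\to\mathbb{R}$ have continuous second order partial derivatives, and for integers $n,m\ge 0$ let $f_{n,m}$ be its Chebyshev approximation polynomial. Then $\lim_{n,m\to\infty} f_{n,m}=f$ uniformly in $[-1,1]^2$; that is, for every $\varepsilon>0$ there is $N$ such that $|f(x,y)-f_{n,m}(x,y)|<\varepsilon$ for all $n,m\ge N$ and all $(x,y)\in[-1,1]^2$.
   Context: $T_n$ denotes the Chebyshev polynomial of the first kind, $T_n(\cos t)=\cos nt$. For a continuous function $f:[-1,1]^2\to\mathbb{R}$ the Chebyshev coefficients are defined, for integers $n,m\ge 1$, by $$\alpha_{0,0}=\frac{1}{\pi^2}\int_{-1}^1\int_{-1}^1\frac{f(x,y)}{\sqrt{1-x^2}\sqrt{1-y^2}}\,dx\,dy,\qquad \alpha_{n,0}=\frac{2}{\pi^2}\int_{-1}^1\int_{-1}^1\frac{f(x,y)T_n(x)}{\sqrt{1-x^2}\sqrt{1-y^2}}\,dx\,dy,$$ $$\alpha_{0,m}=\frac{2}{\pi^2}\int_{-1}^1\int_{-1}^1\frac{f(x,y)T_m(y)}{\sqrt{1-x^2}\sqrt{1-y^2}}\,dx\,dy,\qquad \alpha_{n,m}=\frac{4}{\pi^2}\int_{-1}^1\int_{-1}^1\frac{f(x,y)T_n(x)T_m(y)}{\sqrt{1-x^2}\sqrt{1-y^2}}\,dx\,dy.$$ The Chebyshev approximation polynomial of $f$ is $$f_{n,m}(x,y)=\sum_{k=0}^n\sum_{j=0}^m\alpha_{k,j}T_k(x)T_j(y).$$ *)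

(* Defs.v *)
From Stdlib Require Import Reals Lra.
From Coquelicot Require Import Coquelicot.
Open Scope R_scope.

Definition seg (x : R) : Prop := -1 <= x <= 1.

Definition square (p : R * R) : Prop := seg (fst p) /\ seg (snd p).

(** Partial derivatives on the closed square, relative to the square: [D_in]
    is the derivative along a domain, hence one-sided on the edges.  Values of
    the functions outside the square play no role. *)
Definition is_partial_x (f g : R -> R -> R) : Prop :=
  forall x y, seg x -> seg y ->
    D_in (fun s => f s y) (fun s => g s y) seg x.

Definition is_partial_y (f g : R -> R -> R) : Prop :=
  forall x y, seg x -> seg y ->
    D_in (fun t => f x t) (fun t => g x t) seg y.

Definition continuous_on_square (g : R -> R -> R) : Prop :=
  continuous_on square (fun p : R * R => g (fst p) (snd p)).

(** Continuity of [f], [fx] and [fy] need not be required: it follows from the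
    boundedness of the second order partial derivatives. *)
Definition continuous_second_partials (f : R -> R -> R) : Prop :=
  exists fx fy fxx fxy fyx fyy : R -> R -> R,
    is_partial_x f fx /\ is_partial_y f fy /\
    is_partial_x fx fxx /\ is_partial_y fx fxy /\
    is_partial_x fy fyx /\ is_partial_y fy fyy /\
    continuous_on_square fxx /\ continuous_on_square fxy /\
    continuous_on_square fyx /\ continuous_on_square fyy.

Fixpoint cheb (n : nat) (x : R) : R :=
  match n with
  | O => 1
  | S p => match p with
           | O => x
           | S q => 2 * x * cheb p x - cheb q x
           end
  end.

Lemma cheb_cos (n : nat) (t : R) : cheb n (cos t) = cos (INR n * t).
Proof.
assert (H : cheb n (cos t) = cos (INR n * t) /\
            cheb (S n) (cos t) = cos (INR (S n) * t)).
{ induction n as [|n [IH1 IH2]].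
  - simpl. rewrite Rmult_0_l, Rmult_1_l, cos_0. split; reflexivity.
  - split; [exact IH2|].
    change (2 * cos t * cheb (S n) (cos t) - cheb n (cos t)
            = cos (INR (S (S n)) * t)).
    rewrite IH1, IH2.
    replace (INR (S (S n)) * t) with (INR (S n) * t + t)
      by (rewrite (S_INR (S n)); ring).
    replace (INR n * t) with (INR (S n) * t - t)
      by (rewrite (S_INR n); ring).
    rewrite cos_plus, cos_minus. ring. }
exact (proj1 H).
Qed.

(** The weight is singular on the boundary, so the integrals are improper
    Riemann integrals: limits of integrals over [a, b] as a -> -1+, b -> 1-. *)
Definition integral_11 (g : R -> R) : R :=
  RInt_gen g (at_right (-1)) (at_left 1).

Definition weighted_integral (g : R -> R -> R) : R :=
  integral_11 (fun y => integral_11 (fun x =>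
    g x y / (sqrt (1 - x ^ 2) * sqrt (1 - y ^ 2)))).

Definition cheb_coef (f : R -> R -> R) (n m : nat) : R :=
  match n, m with
  | O, O => 1 / PI ^ 2 * weighted_integral f
  | S _, O => 2 / PI ^ 2 * weighted_integral (fun x y => f x y * cheb n x)
  | O, S _ => 2 / PI ^ 2 * weighted_integral (fun x y => f x y * cheb m y)
  | S _, S _ =>
      4 / PI ^ 2 * weighted_integral (fun x y => f x y * cheb n x * cheb m y)
  end.

Definition cheb_approx (f : R -> R -> R) (n m : nat) (x y : R) : R :=
  sum_f_R0 (fun k =>
    sum_f_R0 (fun j => cheb_coef f k j * cheb k x * cheb j y) m) n.

(* Main.v *)
(** In the variables [x = cos s], [y = cos t] the Chebyshev partial sums of [f]
    are the cosine partial sums of [F(s,t) = f(cos s, cos t)], taken first in [s]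
    and then in [t].  In one variable, integrating the Dirichlet kernel by parts
    writes [G - partial_sum n G] as an integral of [G'] against the remainders
    [saw n] of the Fourier series of the sawtooth, and
    [|saw n v| <= 17 / sqrt (1 + (n + 1) v)] gives the uniform error
    [O(sup |G'| / sqrt n)].  In two variables let [H t] be the partial sum of
    order [n] of [F(., t)] at [s].  Then [F - H] is [O(1 / sqrt n)], and [H'] is
    the partial sum of [F_t(., t)], bounded because [F_ts] is, so that the
    partial sum of order [m] of [H] differs from [H] by [O(1 / sqrt m)]. *)

Require Import Defs.
From Stdlib Require Import Reals Lra.
From Coquelicot Require Import Coquelicot.
Open Scope R_scope.

(** * The remainders of the sawtooth series *)

(** The normalization of cosine coefficients on [[0, PI]], where the constant mode has half the
    factor of the others. The products [weight k * weight j] are the constants 1, 2 and 4 of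
    [cheb_coef]. *)
Definition weight (k : nat) : R := match k with O => 1 | S _ => 2 end.

Definition dirichlet (n : nat) (v : R) : R :=
  sum_f_R0 (fun k => weight k / 2 * cos (INR k * v)) n.

(** The term of index [0] is [0], since [/ 0] is multiplied by [sin 0]. *)
Definition saw (n : nat) (v : R) : R :=
  sum_f_R0 (fun k => sin (INR k * v) / INR k) n - (PI - v) / 2.

Lemma dirichlet_S (n : nat) (v : R) :
  dirichlet (S n) v = dirichlet n v + cos (INR (S n) * v).
Proof. unfold dirichlet; rewrite tech5; cbn [weight]; field. Qed.

Lemma saw_S (n : nat) (v : R) :
  saw (S n) v = saw n v + sin (INR (S n) * v) / INR (S n).
Proof. unfold saw; rewrite tech5; ring. Qed.

Lemma saw_0 (v : R) : saw 0 v = - (PI - v) / 2.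
Proof. unfold saw; simpl; rewrite Rmult_0_l, sin_0; unfold Rdiv; ring. Qed.

Lemma dirichlet_0 (v : R) : dirichlet 0 v = 1 / 2.
Proof. unfold dirichlet; simpl; rewrite Rmult_0_l, cos_0; field. Qed.

Lemma dirichlet_opp (n : nat) (v : R) : dirichlet n (- v) = dirichlet n v.
Proof.
apply sum_eq; intros k _.
now rewrite Ropp_mult_distr_r_reverse, cos_neg.
Qed.

(** Each sine term differentiates to its cosine, and [- (PI - v) / 2] supplies the constant [1 / 2]
    of the kernel. *)
Lemma is_derive_saw (n : nat) (v : R) : is_derive (saw n) v (dirichlet n v).
Proof.
induction n as [|n IH].
- apply (is_derive_ext (fun v => - (PI - v) / 2)).
  { intros t; symmetry; apply saw_0. }
  rewrite dirichlet_0; auto_derive; [exact I | field].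
- apply (is_derive_ext (fun v => saw n v + sin (INR (S n) * v) / INR (S n))).
  { intros t; symmetry; apply saw_S. }
  rewrite dirichlet_S.
  apply (is_derive_plus (saw n) _ v _ _ IH).
  assert (0 < INR (S n)) by apply lt_0_INR, PeanoNat.Nat.lt_0_succ.
  generalize dependent (INR (S n)); intros k Hk.
  auto_derive; [exact I | field; lra].
Qed.

Lemma continuous_saw (n : nat) (v : R) : continuous (saw n) v.
Proof. apply (ex_derive_continuous (saw n)); eexists; apply is_derive_saw. Qed.

Lemma continuous_dirichlet (n : nat) (v : R) : continuous (dirichlet n) v.
Proof.
apply (ex_derive_continuous (dirichlet n)).
induction n as [|n IH].
- apply (ex_derive_ext (fun _ => 1 / 2)).
  { intros t; symmetry; apply dirichlet_0. }
  apply ex_derive_const.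
- apply (ex_derive_ext (fun v => dirichlet n v + cos (INR (S n) * v))).
  { intros t; symmetry; apply dirichlet_S. }
  apply (ex_derive_plus (dirichlet n)); [exact IH | auto_derive; exact I].
Qed.

(** The sum telescopes: [2 * sin (v / 2) * cos (k * v)] is the difference of [sin ((k + / 2) * v)]
    and [sin ((k - / 2) * v)]. *)
Lemma sin_mult_dirichlet (n : nat) (v : R) :
  2 * sin (v / 2) * dirichlet n v = sin ((INR n + / 2) * v).
Proof.
induction n as [|n IH].
- rewrite dirichlet_0; simpl.
  replace ((0 + / 2) * v) with (v / 2) by field; field.
- rewrite dirichlet_S, Rmult_plus_distr_l, IH, S_INR.
  replace ((INR n + / 2) * v) with ((INR n + 1) * v - v / 2) by field.
  replace ((INR n + 1 + / 2) * v) with ((INR n + 1) * v + v / 2) by field.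
  rewrite sin_plus, sin_minus; ring.
Qed.

Lemma saw_PI (n : nat) : saw n PI = 0.
Proof.
induction n as [|n IH].
- rewrite saw_0; field.
- rewrite saw_S, IH.
  replace (sin (INR (S n) * PI)) with 0; [unfold Rdiv; ring|].
  symmetry; apply sin_eq_0_1; exists (Z.of_nat (S n)).
  now rewrite INR_IZR_INZ.
Qed.

Lemma saw_reflect (n : nat) (v : R) : saw n (2 * PI - v) = - saw n v.
Proof.
induction n as [|n IH].
- rewrite !saw_0; field.
- rewrite !saw_S, IH.
  replace (INR (S n) * (2 * PI - v))
    with (- (INR (S n) * v) + 2 * INR (S n) * PI) by ring.
  rewrite sin_period, sin_neg; unfold Rdiv; ring.
Qed.

Lemma nonincreasing_of_derive (g dg : R -> R) (a b : R) :
  a <= b -> (forall x, a <= x <= b -> is_derive g x (dg x)) ->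
  (forall x, a <= x <= b -> dg x <= 0) -> g b <= g a.
Proof.
intros Hab Hd Hneg.
destruct (MVT_gen g a b dg) as [c [Hc Heq]].
- intros x; rewrite Rmin_left, Rmax_right by lra; intros Hx; apply Hd; lra.
- intros x; rewrite Rmin_left, Rmax_right by lra; intros Hx.
  apply continuity_pt_filterlim; apply (ex_derive_continuous g).
  eexists; apply Hd; lra.
- rewrite Rmin_left, Rmax_right in Hc by lra.
  specialize (Hneg c Hc); nra.
Qed.

(* With [h v = 1 / ((2n+1) sin (v/2))] and
   [q v = saw n v + cos ((n+1/2) v) h v], one finds [q' = cos ((n+1/2) v) h'],
   so [h + q] and [h - q] are nonincreasing, and [q PI = 0]. *)
Lemma saw_le_inv_sin (n : nat) (v : R) :
  0 < v <= PI ->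
  Rabs (saw n v) <= 2 / ((2 * INR n + 1) * sin (v / 2)).
Proof.
intros Hv.
set (N := 2 * INR n + 1).
assert (HN : 0 < N) by (unfold N; pose proof (pos_INR n); lra).
set (h := fun v => / (N * sin (v / 2))).
set (q := fun v => saw n v + cos ((INR n + / 2) * v) * h v).
set (dh := fun v => - cos (v / 2) / (2 * N * sin (v / 2) ^ 2)).
assert (Hs : forall x, v <= x <= PI -> 0 < sin (x / 2)).
{ intros x Hx; apply sin_gt_0; pose proof PI_RGT_0; lra. }
assert (Hc : forall x, v <= x <= PI -> 0 <= cos (x / 2)).
{ intros x Hx; apply cos_ge_0; pose proof PI_RGT_0; lra. }
assert (Hh : forall x, v <= x <= PI -> is_derive h x (dh x)).
{ intros x Hx; specialize (Hs x Hx); unfold h, dh.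
  auto_derive; [nra | unfold Rdiv in *; field; split; lra]. }
assert (Hq : forall x, v <= x <= PI ->
          is_derive q x (cos ((INR n + / 2) * x) * dh x)).
{ intros x Hx; specialize (Hs x Hx).
  replace (cos ((INR n + / 2) * x) * dh x) with
    (dirichlet n x + (- (INR n + / 2) * sin ((INR n + / 2) * x) * h x
        + cos ((INR n + / 2) * x) * dh x)).
  - apply (is_derive_plus (saw n)); [apply is_derive_saw|].
    apply (is_derive_mult (fun x => cos ((INR n + / 2) * x)) h x
             (- (INR n + / 2) * sin ((INR n + / 2) * x)) (dh x));
      [auto_derive; [exact I | ring] | now apply Hh | intros; apply Rmult_comm].
  (* By the closed form of the kernel, [(n + 1/2) sin ((n + 1/2) x) h x] equals [dirichlet n x], so
     these two terms cancel and only the one with [dh] is left. *)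
  - rewrite <- sin_mult_dirichlet; unfold h.
    replace (INR n + / 2) with (N / 2) by (unfold N; field).
    field; split; lra. }
assert (Hdh : forall x, v <= x <= PI -> dh x <= 0).
{ intros x Hx; specialize (Hs x Hx); specialize (Hc x Hx); unfold dh.
  unfold Rdiv; rewrite Ropp_mult_distr_l_reverse.
  assert (0 < / (2 * N * sin (x / 2) ^ 2)) by
    (apply Rinv_0_lt_compat, Rmult_lt_0_compat; [lra | now apply pow_lt]).
  nra. }
assert (HqPI : q PI = 0).
{ unfold q; rewrite saw_PI.
  replace ((INR n + / 2) * PI) with (INR n * PI + PI / 2) by field.
  rewrite cos_plus, cos_PI2, sin_PI2.
  replace (sin (INR n * PI)) with 0; [ring|].
  symmetry; apply sin_eq_0_1; exists (Z.of_nat n).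
  now rewrite INR_IZR_INZ. }
assert (HhPI : 0 < h PI).
{ unfold h; apply Rinv_0_lt_compat, Rmult_lt_0_compat; [lra|]; apply Hs; lra. }
assert (Hp : h PI + q PI <= h v + q v).
{ apply (nonincreasing_of_derive (fun x => h x + q x)
           (fun x => dh x + cos ((INR n + / 2) * x) * dh x)); [lra| |].
  - intros x Hx; apply (is_derive_plus h q); auto.
  - intros x Hx; specialize (Hdh x Hx).
    pose proof (COS_bound ((INR n + / 2) * x)); nra. }
assert (Hm : h PI - q PI <= h v - q v).
{ apply (nonincreasing_of_derive (fun x => h x - q x)
           (fun x => dh x - cos ((INR n + / 2) * x) * dh x)); [lra| |].
  - intros x Hx; apply (is_derive_minus h q); auto.
  - intros x Hx; specialize (Hdh x Hx).
    pose proof (COS_bound ((INR n + / 2) * x)); nra. }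
assert (Hhv : 0 < h v).
{ unfold h; apply Rinv_0_lt_compat, Rmult_lt_0_compat; [lra|]; apply Hs; lra. }
(* Since [q PI = 0] and [h PI > 0], monotonicity gives [|q v| <= h v]. The cosine term separating
   [q] from [saw] costs at most another [h v]. *)
replace (2 / (N * sin (v / 2))) with (2 * h v) by (unfold h; field;
  split; [apply Rgt_not_eq, Hs; lra | lra]).
pose proof (COS_bound ((INR n + / 2) * v)).
assert (q v = saw n v + cos ((INR n + / 2) * v) * h v) by reflexivity.
apply Rabs_le; split; nra.
Qed.

(** The Taylor bound [x - x^3 / 6 <= sin x] suffices, because [x^2 / 6 <= 2 / 3] on this interval.
    It will be applied at [v / 2] with [v <= PI <= 4]. *)
Lemma sin_ge_third (x : R) : 0 <= x <= 2 -> x / 3 <= sin x.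
Proof.
intros Hx.
destruct (pre_sin_bound x 0) as [H _]; [lra | lra |].
revert H; unfold sin_approx, sin_term; simpl; intros H.
nra.
Qed.

(** Each sine term is at most [v] in absolute value, and the linear term at most [PI / 2 <= 2]. This
    controls [saw] near 0, where the bound by the inverse sine blows up. *)
Lemma saw_le_linear (n : nat) (v : R) :
  0 <= v <= PI -> Rabs (saw n v) <= INR n * v + 2.
Proof.
intros Hv; pose proof PI_4.
induction n as [|n IH].
- rewrite saw_0; simpl; apply Rabs_le; lra.
- rewrite saw_S, S_INR.
  assert (Hn : 0 < INR n + 1) by (pose proof (pos_INR n); lra).
  eapply Rle_trans; [apply Rabs_triang|].
  assert (Rabs (sin ((INR n + 1) * v) / (INR n + 1)) <= v); [|lra].
  unfold Rdiv; rewrite Rabs_mult, (Rabs_right (/ _))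
    by (apply Rle_ge, Rlt_le, Rinv_0_lt_compat, Hn).
  apply (Rmult_le_reg_r (INR n + 1)); [lra|].
  rewrite Rmult_assoc, Rinv_l, Rmult_1_r by lra.
  assert (Hs : forall x, 0 <= x -> Rabs (sin x) <= x).
  { intros x Hx; destruct (Req_dec x 0) as [->|Hx0].
    - rewrite sin_0, Rabs_R0; lra.
    - destruct (Rle_lt_dec x 1) as [H1|H1].
      + pose proof (sin_lt_x x ltac:(lra)).
        pose proof (sin_ge_third x ltac:(lra)).
        apply Rabs_le; lra.
      + pose proof (SIN_bound x); apply Rabs_le; lra. }
  specialize (Hs ((INR n + 1) * v)); nra.
Qed.

(** Interpolates between the two previous bounds, with [p = (n + 1) v] as the natural scale. The
    inverse square root is finite at 0 and has an elementary primitive. *)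
Lemma saw_le_inv_sqrt (n : nat) (v : R) :
  0 <= v <= PI -> Rabs (saw n v) <= 17 / sqrt (1 + (INR n + 1) * v).
Proof.
intros Hv.
pose proof (pos_INR n) as Hn; pose proof PI_4 as HPI.
set (p := (INR n + 1) * v).
assert (Hp : 0 <= p) by (unfold p; nra).
set (w := Rabs (saw n v)).
assert (Hw : 0 <= w) by apply Rabs_pos.
assert (Hw1 : w <= p + 2).
{ eapply Rle_trans; [now apply saw_le_linear|]; unfold p; nra. }
(* Here [sin (v / 2) >= v / 6] and [2n + 1 >= n + 1] make the denominator at least [p / 6], whence
   [w * p / 6 <= 2]. *)
assert (Hw2 : p * w <= 12).
{ destruct (Req_dec v 0) as [->|Hv0]; [unfold p; lra|].
  pose proof (sin_ge_third (v / 2) ltac:(lra)) as Hs.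
  pose proof (saw_le_inv_sin n v ltac:(lra)) as H; fold w in H.
  assert (Hd : 0 < (2 * INR n + 1) * sin (v / 2)) by nra.
  assert (w * ((2 * INR n + 1) * sin (v / 2)) <= 2).
  { apply (Rmult_le_compat_r _ _ _ (Rlt_le _ _ Hd)) in H.
    unfold Rdiv in H; rewrite Rmult_assoc, Rinv_l in H by lra; lra. }
  assert (p / 6 <= (2 * INR n + 1) * sin (v / 2)) by (unfold p; nra).
  nra. }
(* For [p <= 1], [w <= 3]. For [p > 1], both [w] and [p * w] are at most 12, so the left side is at
   most [144 + 144 = 288 < 17 * 17]. *)
assert (Hsq : w * w * (1 + p) <= 17 * 17).
{ destruct (Rle_lt_dec p 1); [nra|].
  assert (w <= 12) by nra. nra. }
assert (Hr : 0 < sqrt (1 + p)) by (apply sqrt_lt_R0; lra).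
apply (Rmult_le_reg_r (sqrt (1 + p))); [exact Hr|].
unfold Rdiv; rewrite Rmult_assoc, Rinv_l, Rmult_1_r by lra.
pose proof (sqrt_sqrt (1 + p) ltac:(lra)).
apply Rsqr_incr_0; unfold Rsqr; [|nra|lra].
nra.
Qed.

(** * Cosine partial sums in one variable *)

(* Coquelicot states equalities in the carrier of a structure on [R], where
   [ring] does not recognize the type. *)
Ltac real_ring := match goal with |- @eq _ ?a ?b => change (@eq R a b) end; ring.

(** The Fourier cosine coefficients of the even [2 * PI]-periodic extension of [G] from
    [[0, PI]]. *)
Definition coef (G : R -> R) (k : nat) : R :=
  weight k / PI * RInt (fun u => G u * cos (INR k * u)) 0 PI.

Definition partial_sum (n : nat) (G : R -> R) (s : R) : R :=
  sum_f_R0 (fun k => coef G k * cos (INR k * s)) n.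

Lemma continuous_cos_mult (c u : R) : continuous (fun u => cos (c * u)) u.
Proof. apply (ex_derive_continuous (fun u => cos (c * u))); auto_derive; exact I. Qed.

Lemma continuous_mult_cos (G : R -> R) (c u : R) :
  continuous G u -> continuous (fun u => G u * cos (c * u)) u.
Proof.
intros HG; apply (continuous_mult G (fun u => cos (c * u)) u HG).
apply continuous_cos_mult.
Qed.

Lemma ex_RInt_of_continuous (g : R -> R) (a b : R) :
  (forall u, continuous g u) -> ex_RInt g a b.
Proof. intros Hg; apply (ex_RInt_continuous g); intros; apply Hg. Qed.

(** Termwise this is [2 cos (k s) cos (k u) = cos (k (s + u)) + cos (k (s - u))]. At index 0 the two
    halves from the kernels add up to the weight 1. *)
Lemma partial_sum_dirichlet (n : nat) (G : R -> R) (s : R) :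
  (forall u, continuous G u) ->
  is_RInt (fun u => G u * (dirichlet n (s + u) + dirichlet n (s - u))) 0 PI
    (PI * partial_sum n G s).
Proof.
intros HG; pose proof PI_RGT_0.
assert (Hk : forall k, is_RInt (fun u => G u * cos (INR k * u)) 0 PI
               (RInt (fun u => G u * cos (INR k * u)) 0 PI)).
{ intros k; apply (RInt_correct (fun u => G u * cos (INR k * u))).
  apply ex_RInt_of_continuous; intros u; now apply continuous_mult_cos. }
induction n as [|n IH].
- unfold partial_sum, coef; cbn [sum_f_R0 weight].
  replace (PI * _) with (1 * RInt (fun u => G u * cos (INR 0 * u)) 0 PI)
    by (simpl; rewrite Rmult_0_l, cos_0; field; lra).
  apply (is_RInt_ext (fun u => 1 * (G u * cos (INR 0 * u)))).
  { intros u _; rewrite !dirichlet_0; simpl; rewrite Rmult_0_l, cos_0; field. }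
  apply (is_RInt_scal _ _ _ 1 _ (Hk O)).
- unfold partial_sum; rewrite tech5; fold (partial_sum n G s).
  set (c := 2 * cos (INR (S n) * s)).
  replace (PI * _) with (PI * partial_sum n G s
      + c * RInt (fun u => G u * cos (INR (S n) * u)) 0 PI)
    by (unfold coef, c; cbn [weight]; field; lra).
  apply (is_RInt_ext (fun u =>
     G u * (dirichlet n (s + u) + dirichlet n (s - u))
     + c * (G u * cos (INR (S n) * u)))).
  { intros u _; rewrite !dirichlet_S; unfold c.
    rewrite (Rmult_plus_distr_l (INR (S n))), (Rmult_minus_distr_l (INR (S n))).
  rewrite cos_plus, cos_minus.
  real_ring. }
  apply (is_RInt_plus _ _ _ _ _ _ IH (is_RInt_scal _ _ _ c _ (Hk (S n)))).
Qed.

Lemma is_derive_affine_comp (g : R -> R) (c d u l : R) :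
  is_derive g (c + d * u) l -> is_derive (fun u => g (c + d * u)) u (d * l).
Proof.
intros Hg; apply (is_derive_comp g (fun u => c + d * u) u l d Hg).
auto_derive; [exact I | ring].
Qed.

Lemma continuous_affine_comp (g : R -> R) (c d u : R) :
  continuous g (c + d * u) -> continuous (fun u => g (c + d * u)) u.
Proof.
intros Hg; apply (continuous_comp (fun u => c + d * u) g u); [|exact Hg].
apply (ex_derive_continuous (fun u => c + d * u)); auto_derive; exact I.
Qed.

Lemma is_RInt_by_parts (G dG K dK : R -> R) (a b l : R) :
  (forall u, is_derive G u (dG u)) -> (forall u, continuous dG u) ->
  (forall u, is_derive K u (dK u)) -> (forall u, continuous dK u) ->
  is_RInt (fun u => dG u * K u) a b l ->
  is_RInt (fun u => G u * dK u) a b (G b * K b - G a * K a - l).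
Proof.
intros HG HdG HK HdK Hl.
assert (cG : forall u, continuous G u).
{ intros u; apply (ex_derive_continuous G); eexists; apply HG. }
assert (cK : forall u, continuous K u).
{ intros u; apply (ex_derive_continuous K); eexists; apply HK. }
apply (is_RInt_ext (fun u => (dG u * K u + G u * dK u) - dG u * K u)).
{ intros u _; real_ring. }
apply (is_RInt_minus (fun u => dG u * K u + G u * dK u) (fun u => dG u * K u));
  [|exact Hl].
apply (is_RInt_derive (fun u => G u * K u)).
- intros u _.
  apply (is_derive_mult G K u _ _ (HG u) (HK u)); intros; apply Rmult_comm.
- intros u _.
  apply (continuous_plus (fun u => dG u * K u) (fun u => G u * dK u));
  [apply (continuous_mult dG K) | apply (continuous_mult G dK)]; auto.
Qed.

(** * Integral bounds for the sawtooth remainders *)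

Definition majorant (n : nat) (v : R) : R :=
  17 / sqrt (1 + (INR n + 1) * v) + 17 / sqrt (1 + (INR n + 1) * (2 * PI - v)).

Definition majorant_primitive (n : nat) (v : R) : R :=
  34 / (INR n + 1) * (sqrt (1 + (INR n + 1) * v)
                      - sqrt (1 + (INR n + 1) * (2 * PI - v))).

Lemma one_plus_pos (n : nat) (v : R) :
  0 <= v -> 0 < 1 + (INR n + 1) * v.
Proof. pose proof (pos_INR n); nra. Qed.

(** On each half of the interval one summand is the inverse square root bound, reflected about [PI]
    on the right half, and the other is positive. Adding both spares a case split when
    integrating. *)
Lemma saw_le_majorant (n : nat) (v : R) :
  0 <= v <= 2 * PI -> Rabs (saw n v) <= majorant n v.
Proof.
intros Hv; unfold majorant.
assert (H : forall x, 0 <= x -> 0 < 17 / sqrt (1 + (INR n + 1) * x)).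
{ intros x Hx; apply Rdiv_lt_0_compat; [lra|].
  now apply sqrt_lt_R0, one_plus_pos. }
pose proof (H v ltac:(lra)); pose proof (H (2 * PI - v) ltac:(lra)).
destruct (Rle_lt_dec v PI).
- pose proof (saw_le_inv_sqrt n v ltac:(lra)); lra.
- pose proof (saw_le_inv_sqrt n (2 * PI - v) ltac:(lra)) as Hr.
  rewrite saw_reflect, Rabs_Ropp in Hr; lra.
Qed.

Lemma is_derive_majorant_primitive (n : nat) (v : R) :
  0 <= v <= 2 * PI -> is_derive (majorant_primitive n) v (majorant n v).
Proof.
intros Hv.
pose proof (one_plus_pos n v ltac:(lra)).
pose proof (one_plus_pos n (2 * PI - v) ltac:(lra)).
pose proof (sqrt_lt_R0 (1 + (INR n + 1) * v) ltac:(lra)).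
pose proof (sqrt_lt_R0 (1 + (INR n + 1) * (2 * PI - v)) ltac:(lra)).
pose proof (pos_INR n).
unfold majorant_primitive, majorant.
auto_derive; [lra|].
replace (2 * PI + - v) with (2 * PI - v) by ring.
field; lra.
Qed.

Lemma continuous_majorant (n : nat) (v : R) :
  0 <= v <= 2 * PI -> continuous (majorant n) v.
Proof.
intros Hv; apply (ex_derive_continuous (majorant n)).
pose proof (one_plus_pos n v ltac:(lra)).
pose proof (one_plus_pos n (2 * PI - v) ltac:(lra)).
pose proof (sqrt_lt_R0 (1 + (INR n + 1) * v) ltac:(lra)).
pose proof (sqrt_lt_R0 (1 + (INR n + 1) * (2 * PI - v)) ltac:(lra)).
unfold majorant; auto_derive.
unfold Rminus in *; repeat split; lra.
Qed.

Lemma majorant_primitive_bound (n : nat) (v : R) :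
  0 <= v <= 2 * PI ->
  Rabs (majorant_primitive n v) <= 102 / sqrt (INR n + 1).
Proof.
intros Hv; unfold majorant_primitive.
pose proof (pos_INR n); pose proof PI_4.
assert (Hr : 0 < sqrt (INR n + 1)) by (apply sqrt_lt_R0; lra).
pose proof (sqrt_sqrt (INR n + 1) ltac:(lra)) as Hrr.
(* Since [2 * PI <= 8], one has [1 + (n + 1) x <= 9 (n + 1)]. The difference of two such roots is at
   most [3 * sqrt (n + 1)], and [34 * 3 = 102]. *)
assert (Hb : forall x, 0 <= x <= 2 * PI ->
          0 <= sqrt (1 + (INR n + 1) * x) <= 3 * sqrt (INR n + 1)).
{ intros x Hx; split; [apply sqrt_pos|].
  rewrite <- (sqrt_Rsqr 3) by lra; rewrite <- sqrt_mult; unfold Rsqr; try lra.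
  apply sqrt_le_1_alt; nra. }
rewrite Rabs_mult, Rabs_right by
  (apply Rle_ge, Rlt_le, Rdiv_lt_0_compat; lra).
apply Rle_trans with (34 / (INR n + 1) * (3 * sqrt (INR n + 1))).
- apply Rmult_le_compat_l; [apply Rlt_le, Rdiv_lt_0_compat; lra|].
  pose proof (Hb v ltac:(lra)); pose proof (Hb (2 * PI - v) ltac:(lra)).
  apply Rabs_le; lra.
- right; rewrite <- Hrr at 1; field; lra.
Qed.

Lemma is_RInt_majorant (n : nat) (s e a b : R) :
  e = 1 \/ e = -1 -> a <= b ->
  (forall u, a <= u <= b -> 0 <= s + e * u <= 2 * PI) ->
  is_RInt (fun u => majorant n (s + e * u)) a b
    (e * (majorant_primitive n (s + e * b) - majorant_primitive n (s + e * a))).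
Proof.
intros He Hab Hr.
assert (Hee : e * e = 1) by (destruct He as [-> | ->]; ring).
replace (e * _) with (e * majorant_primitive n (s + e * b)
  - e * majorant_primitive n (s + e * a)) by ring.
apply (is_RInt_derive (fun u => e * majorant_primitive n (s + e * u)));
  rewrite Rmin_left, Rmax_right by lra; intros u Hu.
- replace (majorant n (s + e * u)) with (e * (e * majorant n (s + e * u)))
    by (rewrite <- Rmult_assoc, Hee; ring).
  apply is_derive_scal, is_derive_affine_comp.
  now apply is_derive_majorant_primitive, Hr.
- now apply continuous_affine_comp, continuous_majorant, Hr.
Qed.

(** The integral is at most [M] times that of the majorant, and the two end point values of the
    primitive cost 102 each. The sign [e] covers the arguments [s + u] and [s - u] at once. *)
Lemma RInt_saw_bound (n : nat) (H : R -> R) (M s e a b l : R) :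
  e = 1 \/ e = -1 -> a <= b ->
  (forall u, a <= u <= b -> 0 <= s + e * u <= 2 * PI) ->
  (forall u, Rabs (H u) <= M) ->
  is_RInt (fun u => H u * saw n (s + e * u)) a b l ->
  Rabs l <= M * (204 / sqrt (INR n + 1)).
Proof.
intros He Hab Hr HM Hl.
assert (0 <= M) by (eapply Rle_trans; [apply Rabs_pos | apply (HM 0)]).
apply Rle_trans with (M * (e * (majorant_primitive n (s + e * b)
                               - majorant_primitive n (s + e * a)))).
- apply (norm_RInt_le (fun u => H u * saw n (s + e * u))
           (fun u => M * majorant n (s + e * u)) a b); [exact Hab| |exact Hl|].
  + intros u Hu; unfold norm; simpl; unfold abs; simpl; rewrite Rabs_mult.
    apply Rmult_le_compat; try apply Rabs_pos; [apply HM|].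
    now apply saw_le_majorant, Hr.
  + apply (is_RInt_scal (fun u => majorant n (s + e * u)) a b M).
    now apply is_RInt_majorant.
- apply Rmult_le_compat_l; [assumption|].
  pose proof (majorant_primitive_bound n (s + e * b) ltac:(apply Hr; lra)) as H1.
  pose proof (majorant_primitive_bound n (s + e * a) ltac:(apply Hr; lra)) as H2.
  apply Rabs_le_between in H1; apply Rabs_le_between in H2.
  replace (204 / sqrt (INR n + 1)) with (2 * (102 / sqrt (INR n + 1)))
    by (unfold Rdiv; ring).
  destruct He as [-> | ->]; lra.
Qed.

(* With [D] the Dirichlet kernel, [PI * partial_sum n G s] is the integral of
   [G u * (D (s + u) + D (s - u))] over [0, PI].  Integrating by parts on both
   sides of [u = s], with the primitives [saw (s + u) - saw (s - u)] and
   [saw (s + u) + saw (u - s)], the boundary terms at [0] and [PI] vanish and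
   the jump [- 2 * saw 0 = PI] at [s] produces [PI * G s]. *)
Lemma partial_sum_error (n : nat) (G dG : R -> R) (M s : R) :
  (forall u, is_derive G u (dG u)) -> (forall u, continuous dG u) ->
  (forall u, Rabs (dG u) <= M) -> 0 <= s <= PI ->
  Rabs (G s - partial_sum n G s) <= M * (816 / sqrt (INR n + 1)).
Proof.
intros HG HdG HM Hs; pose proof PI_RGT_0 as HPI.
assert (cG : forall u, continuous G u).
{ intros u; apply (ex_derive_continuous G); eexists; apply HG. }
set (J := fun c e a b => RInt (fun u => dG u * saw n (c + e * u)) a b).
assert (HJ : forall c e a b,
          is_RInt (fun u => dG u * saw n (c + e * u)) a b (J c e a b)).
{ intros c e a b; apply (RInt_correct (fun u => dG u * saw n (c + e * u))).
  apply ex_RInt_of_continuous; intros u.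
  apply (continuous_mult dG); [apply HdG|].
  apply continuous_affine_comp, continuous_saw. }
assert (HK : forall c e a b, is_RInt
   (fun u => G u * (e * dirichlet n (c + e * u))) a b
   (G b * saw n (c + e * b) - G a * saw n (c + e * a) - J c e a b)).
{ intros c e a b.
  apply (is_RInt_by_parts G dG (fun u => saw n (c + e * u))
           (fun u => e * dirichlet n (c + e * u))); auto.
  - intros u; apply is_derive_affine_comp, is_derive_saw.
  - intros u; apply (continuous_scal_r e (fun u => dirichlet n (c + e * u))).
    apply continuous_affine_comp, continuous_dirichlet. }
(* Replacing [s - u] by [u - s] to the right of [s] keeps every argument of [saw] in [[0, 2 * PI]],
   where the majorant is valid. The evenness of the kernel permits it. *)
assert (Hid : PI * (G s - partial_sum n G s)
  = J s 1 0 s - J s (-1) 0 s + (J s 1 s PI + J (- s) 1 s PI)).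
{ pose proof (is_RInt_minus _ _ _ _ _ _ (HK s 1 0 s) (HK s (-1) 0 s)) as I1.
  pose proof (is_RInt_plus _ _ _ _ _ _ (HK s 1 s PI) (HK (- s) 1 s PI)) as I2.
  set (k := fun u => G u * (dirichlet n (s + u) + dirichlet n (s - u))).
  apply (is_RInt_ext _ k) in I1; cycle 1.
  { intros u _; unfold k, minus, plus, opp; simpl.
    replace (s + 1 * u) with (s + u) by ring.
    replace (s + -1 * u) with (s - u) by ring; real_ring. }
  apply (is_RInt_ext _ k) in I2; cycle 1.
  { intros u _; unfold k, minus, plus, opp; simpl.
    replace (s + 1 * u) with (s + u) by ring.
    replace (- s + 1 * u) with (- (s - u)) by ring.
    rewrite dirichlet_opp; real_ring. }
  pose proof (is_RInt_Chasles _ _ _ _ _ _ I1 I2) as I; clear I1 I2; unfold k in I.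
  apply (is_RInt_unique (V := R_CompleteNormedModule)) in I.
  rewrite (is_RInt_unique (V := R_CompleteNormedModule) _ _ _ _
    (partial_sum_dirichlet n G s cG)) in I.
  unfold minus, plus, opp in I; simpl in I.
  replace (s + -1 * s) with 0 in I by ring.
  replace (- s + 1 * s) with 0 in I by ring.
  replace (s + 1 * 0) with s in I by ring.
  replace (s + -1 * 0) with s in I by ring.
  replace (- s + 1 * PI) with (PI - s) in I by ring.
  replace (s + 1 * PI) with (2 * PI - (PI - s)) in I by ring.
  rewrite saw_reflect in I.
  assert (H0 : saw n 0 = - PI / 2).
  { unfold saw. rewrite (sum_eq _ (fun _ => 0)).
    - rewrite sum_cte; lra.
    - intros i _; rewrite Rmult_0_r, sin_0; unfold Rdiv; ring. }
  rewrite H0 in I; lra. }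
assert (B : forall c e a b, e = 1 \/ e = -1 -> a <= b ->
  (forall u, a <= u <= b -> 0 <= c + e * u <= 2 * PI) ->
  Rabs (J c e a b) <= M * (204 / sqrt (INR n + 1))).
{ intros c e a b He Hab Hr.
  now apply (RInt_saw_bound n dG M c e a b). }
pose proof (B s 1 0 s ltac:(auto) ltac:(lra) ltac:(intros; lra)) as B1.
pose proof (B s (-1) 0 s ltac:(auto) ltac:(lra) ltac:(intros; lra)) as B2.
pose proof (B s 1 s PI ltac:(auto) ltac:(lra) ltac:(intros; lra)) as B3.
pose proof (B (- s) 1 s PI ltac:(auto) ltac:(lra) ltac:(intros; lra)) as B4.
replace (816 / sqrt (INR n + 1)) with (4 * (204 / sqrt (INR n + 1)))
  by (unfold Rdiv; ring).
assert (1 <= PI) by (pose proof PI2_1; lra).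
apply Rabs_le_between in B1; apply Rabs_le_between in B2.
apply Rabs_le_between in B3; apply Rabs_le_between in B4.
apply Rabs_le; nra.
Qed.

(** * Cosine partial sums in two variables *)

Lemma continuous_slice_1 (g : R -> R -> R) (s t : R) :
  continuity_2d_pt g s t -> continuous (fun s => g s t) s.
Proof.
intros Hg; apply continuity_pt_filterlim, continuity_pt_locally; intros eps.
destruct (Hg eps) as [d Hd]; exists d; intros u Hu; apply Hd; [exact Hu|].
rewrite Rminus_diag, Rabs_R0; apply cond_pos.
Qed.

Lemma continuous_RInt_param (g : R -> R -> R) (a b t : R) :
  a <= b -> (forall s t, continuity_2d_pt g s t) ->
  continuous (fun t => RInt (fun s => g s t) a b) t.
Proof.
intros Hab Hg; apply continuity_pt_filterlim, continuity_pt_locally; intros eps.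
(* The added 1 keeps the divisor positive when [a = b] and makes the final inequality strict. *)
assert (Hc : 0 < eps / (b - a + 1)) by (apply Rdiv_lt_0_compat; [apply eps | lra]).
destruct (uniform_continuity_2d_1d g a b t (fun s _ => Hg s t) (mkposreal _ Hc))
  as [d Hd]; simpl in Hd.
assert (Hint : forall t, ex_RInt (fun s => g s t) a b).
{ intros t'; apply ex_RInt_of_continuous; intros s; now apply continuous_slice_1. }
exists d; intros t' Ht'; apply Rabs_lt_between' in Ht'.
pose proof (cond_pos d); pose proof (cond_pos eps).
rewrite <- (RInt_minus (V := R_CompleteNormedModule)) by apply Hint.
apply Rle_lt_trans with ((b - a) * (eps / (b - a + 1))).
- apply abs_RInt_le_const; [exact Hab | |].
  + apply (ex_RInt_minus (fun s => g s t') (fun s => g s t)); apply Hint.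
  + intros s Hs; apply Rlt_le, Hd; try lra.
    rewrite Rminus_diag, Rabs_R0; lra.
- apply Rlt_le_trans with ((b - a + 1) * (eps / (b - a + 1)));
    [apply Rmult_lt_compat_r; lra | right; field; lra].
Qed.

Lemma is_derive_RInt_param' (g dg : R -> R -> R) (a b t : R) :
  (forall s t, is_derive (fun t => g s t) t (dg s t)) ->
  (forall s t, continuity_2d_pt dg s t) ->
  (forall t, ex_RInt (fun s => g s t) a b) ->
  is_derive (fun t => RInt (fun s => g s t) a b) t (RInt (fun s => dg s t) a b).
Proof.
intros Hd Hc Hi.
rewrite (RInt_ext (fun s => dg s t) (fun s => Derive (fun t => g s t) t))
  by (intros s _; symmetry; now apply is_derive_unique).
apply (is_derive_RInt_param (fun t s => g s t)).
- apply filter_forall; intros u s _; eexists; apply Hd.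
- intros s _; apply (continuity_2d_pt_ext (fun u v => dg v u)).
  + intros u v; symmetry; now apply is_derive_unique.
  + intros eps; destruct (Hc s t eps) as [d H]; exists d; auto.
- now apply filter_forall.
Qed.

Lemma continuity_2d_pt_mult_cos (g : R -> R -> R) (c s t : R) :
  continuity_2d_pt g s t -> continuity_2d_pt (fun s t => g s t * cos (c * s)) s t.
Proof.
intros Hg; apply continuity_2d_pt_mult; [exact Hg|].
apply (continuity_1d_2d_pt_comp (fun s => cos (c * s)) (fun s _ => s)).
- apply continuity_pt_filterlim, continuous_cos_mult.
- apply continuity_2d_pt_id1.
Qed.

Lemma continuous_coef_param (g : R -> R -> R) (k : nat) (t : R) :
  (forall s t, continuity_2d_pt g s t) ->
  continuous (fun t => coef (fun s => g s t) k) t.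
Proof.
intros Hg; unfold coef.
apply (continuous_scal_r (weight k / PI)
         (fun t => RInt (fun u => g u t * cos (INR k * u)) 0 PI)).
apply (continuous_RInt_param (fun u t => g u t * cos (INR k * u)));
  [apply Rlt_le, PI_RGT_0|].
intros; now apply continuity_2d_pt_mult_cos.
Qed.

Lemma is_derive_coef_param (g dg : R -> R -> R) (k : nat) (t : R) :
  (forall s t, continuous (fun s => g s t) s) ->
  (forall s t, is_derive (fun t => g s t) t (dg s t)) ->
  (forall s t, continuity_2d_pt dg s t) ->
  is_derive (fun t => coef (fun s => g s t) k) t (coef (fun s => dg s t) k).
Proof.
intros Hg Hd Hc; unfold coef.
apply (is_derive_scal (fun t => RInt (fun u => g u t * cos (INR k * u)) 0 PI)).
apply (is_derive_RInt_param' (fun u t => g u t * cos (INR k * u))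
         (fun u t => dg u t * cos (INR k * u))).
- intros s u.
  apply (is_derive_ext (fun t => cos (INR k * s) * g s t)).
  { intros; apply Rmult_comm. }
  rewrite (Rmult_comm (dg s u)); now apply (is_derive_scal (g s)).
- intros; now apply continuity_2d_pt_mult_cos.
- intros u; apply ex_RInt_of_continuous; intros s.
  now apply (continuous_mult_cos (fun s => g s u)).
Qed.

Lemma continuous_partial_sum_param (n : nat) (g : R -> R -> R) (s t : R) :
  (forall k t, continuous (fun t => coef (fun s => g s t) k) t) ->
  continuous (fun t => partial_sum n (fun s => g s t) s) t.
Proof.
intros Hg; unfold partial_sum.
induction n as [|n IH]; cbn [sum_f_R0].
- apply (continuous_mult (fun t => coef (fun s => g s t) 0)); [apply Hg | apply continuous_const].
- apply (continuous_plus
    (fun t => sum_f_R0 (fun k => coef (fun s => g s t) k * cos (INR k * s)) n)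
    (fun t => coef (fun s => g s t) (S n) * cos (INR (S n) * s))); [exact IH|].
  apply (continuous_mult (fun t => coef (fun s => g s t) (S n))); [apply Hg | apply continuous_const].
Qed.

Lemma is_derive_partial_sum_param (n : nat) (g dg : R -> R -> R) (s t : R) :
  (forall k t, is_derive (fun t => coef (fun s => g s t) k) t
                 (coef (fun s => dg s t) k)) ->
  is_derive (fun t => partial_sum n (fun s => g s t) s) t
    (partial_sum n (fun s => dg s t) s).
Proof.
intros Hg; unfold partial_sum.
induction n as [|n IH]; cbn [sum_f_R0].
- apply (is_derive_scal_l (V := R_NormedModule) (fun t => coef (fun s => g s t) 0)), Hg.
- apply (is_derive_plus
    (fun t => sum_f_R0 (fun k => coef (fun s => g s t) k * cos (INR k * s)) n)
    (fun t => coef (fun s => g s t) (S n) * cos (INR (S n) * s))); [exact IH|].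
  apply (is_derive_scal_l (V := R_NormedModule) (fun t => coef (fun s => g s t) (S n))), Hg.
Qed.

Lemma coef_ext (G H : R -> R) (k : nat) :
  (forall u, G u = H u) -> coef G k = coef H k.
Proof.
intros E; unfold coef; f_equal; apply RInt_ext; intros u _; now rewrite E.
Qed.

Lemma partial_sum_ext (m : nat) (G H : R -> R) (t : R) :
  (forall u, G u = H u) -> partial_sum m G t = partial_sum m H t.
Proof. intros E; apply sum_eq; intros k _; now rewrite (coef_ext G H). Qed.

Lemma partial_sum_plus_scal (m : nat) (G H : R -> R) (c t : R) :
  (forall u, continuous G u) -> (forall u, continuous H u) ->
  partial_sum m (fun u => G u + H u * c) t
  = partial_sum m G t + partial_sum m H t * c.
Proof.
intros HG HH; unfold partial_sum.
rewrite (Rmult_comm _ c), scal_sum, <- plus_sum.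
apply sum_eq; intros k _.
assert (coef (fun u => G u + H u * c) k = coef G k + coef H k * c) as ->; [|ring].
unfold coef; set (w := weight k / PI).
rewrite Rmult_assoc, (Rmult_comm _ c), <- Rmult_plus_distr_l; f_equal.
apply (is_RInt_unique (V := R_CompleteNormedModule)).
apply (is_RInt_ext (fun u => G u * cos (INR k * u) + c * (H u * cos (INR k * u)))).
{ intros u _; real_ring. }
apply (is_RInt_plus (fun u => G u * cos (INR k * u))
         (fun u => c * (H u * cos (INR k * u))));
  [| apply (is_RInt_scal (fun u => H u * cos (INR k * u)))];
  apply (RInt_correct (V := R_CompleteNormedModule)), ex_RInt_of_continuous;
  intros u; now apply continuous_mult_cos.
Qed.

(** Iterated instead of written as a double sum, so that the one-variable error estimate can be used
    once in each variable. *)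
Definition double_partial_sum (n m : nat) (F : R -> R -> R) (s t : R) : R :=
  partial_sum m (fun t' => partial_sum n (fun s' => F s' t') s) t.

(** The outer partial sum is linear, so it passes through the finite inner sum; the induction on [n]
    splits off the last inner term. *)
Lemma double_partial_sum_sum (n m : nat) (F : R -> R -> R) (s t : R) :
  (forall k t, continuous (fun t => coef (fun s => F s t) k) t) ->
  double_partial_sum n m F s t
  = sum_f_R0 (fun k => sum_f_R0 (fun j =>
      coef (fun t' => coef (fun s' => F s' t') k) j
      * cos (INR k * s) * cos (INR j * t)) m) n.
Proof.
intros HF.
assert (Hrow : forall k,
  sum_f_R0 (fun j => coef (fun t' => coef (fun s' => F s' t') k) j
      * cos (INR k * s) * cos (INR j * t)) m
  = partial_sum m (fun t' => coef (fun s' => F s' t') k) t * cos (INR k * s)).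
{ intros k; unfold partial_sum; rewrite (Rmult_comm (sum_f_R0 _ _)), scal_sum.
  apply sum_eq; intros; ring. }
rewrite (sum_eq _ _ n (fun k _ => Hrow k)); clear Hrow.
unfold double_partial_sum; induction n as [|n IH].
- cbn [sum_f_R0].
  (* The zero function is added to bring the single term into the shape of
     [partial_sum_plus_scal]. *)
  transitivity (partial_sum m
    (fun t' => 0 + coef (fun s' => F s' t') 0 * cos (INR 0 * s)) t).
  + apply partial_sum_ext; intros u; unfold partial_sum; cbn [sum_f_R0]; ring.
  + rewrite (partial_sum_plus_scal m (fun _ => 0)
      (fun t' => coef (fun s' => F s' t') 0));
      [|intros; apply continuous_const | apply HF].
    replace (partial_sum m (fun _ => 0) t) with 0; [ring|].
    unfold partial_sum; rewrite (sum_eq _ (fun _ => 0)); [rewrite sum_cte; ring|].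
    intros j _; unfold coef.
    rewrite (RInt_ext _ (fun _ => 0)) by (intros u _; apply Rmult_0_l).
    rewrite RInt_const; unfold scal; simpl; unfold mult; simpl; ring.
- cbn [sum_f_R0]; rewrite <- IH, <- partial_sum_plus_scal.
  + reflexivity.
  + intros u; now apply continuous_partial_sum_param.
  + apply HF.
Qed.

Lemma double_partial_sum_error (n m : nat) (F Fs Ft Fts : R -> R -> R)
  (M s t : R) :
  (forall s t, is_derive (fun s => F s t) s (Fs s t)) ->
  (forall s t, is_derive (fun t => F s t) t (Ft s t)) ->
  (forall s t, is_derive (fun s => Ft s t) s (Fts s t)) ->
  (forall s t, continuous (fun s => Fs s t) s) ->
  (forall s t, continuity_2d_pt Ft s t) ->
  (forall s t, continuous (fun s => Fts s t) s) ->
  (forall s t, Rabs (Fs s t) <= M) -> (forall s t, Rabs (Ft s t) <= M) ->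
  (forall s t, Rabs (Fts s t) <= M) ->
  0 <= s <= PI -> 0 <= t <= PI ->
  Rabs (F s t - double_partial_sum n m F s t)
  <= M * (816 / sqrt (INR n + 1))
     + (M + M * (816 / sqrt (INR n + 1))) * (816 / sqrt (INR m + 1)).
Proof.
intros HFs HFt HFts cFs cFt cFts bFs bFt bFts Hs Ht.
set (e := 816 / sqrt (INR n + 1)).
set (H := fun t' => partial_sum n (fun s' => F s' t') s).
set (dH := fun t' => partial_sum n (fun s' => Ft s' t') s).
assert (E1 : Rabs (F s t - H t) <= M * e).
{ apply (partial_sum_error n (fun s => F s t) (fun s => Fs s t)); auto. }
assert (E2 : Rabs (H t - double_partial_sum n m F s t)
             <= (M + M * e) * (816 / sqrt (INR m + 1))).
{ apply (partial_sum_error m H dH); auto.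
  - intros u; apply (is_derive_partial_sum_param n F Ft); intros k v.
    apply (is_derive_coef_param F Ft); auto.
    intros s' t'; apply (ex_derive_continuous (fun s => F s t')).
    eexists; apply HFs.
  - intros u; apply (continuous_partial_sum_param n Ft); intros k v.
    now apply (continuous_coef_param Ft).
  - intros u.
    (* The one-variable estimate for [Ft], with [Fts] as its derivative in [s], puts [dH u] within
       [M * e] of [Ft s u], hence [|dH u| <= M + M * e]. *)
    pose proof (partial_sum_error n (fun s => Ft s u) (fun s => Fts s u) M s
      (fun v => HFts v u) (fun v => cFts v u) (fun v => bFts v u) Hs) as E.
    fold e in E; fold (dH u) in E; specialize (bFt s u).
    apply Rabs_le_between in E; apply Rabs_le_between in bFt.
    apply Rabs_le; lra. }
replace (F s t - double_partial_sum n m F s t)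
  with ((F s t - H t) + (H t - double_partial_sum n m F s t)) by ring.
eapply Rle_trans; [apply Rabs_triang | lra].
Qed.

(** * Chebyshev coefficients *)

(** As [acos] is not differentiable at the end points, its limits there are derived from the
    monotonicity of [cos]: [acos x >= e] would force [x <= cos e]. *)
Lemma filterlim_acos_at_left_1 : filterlim acos (at_left 1) (locally 0).
Proof.
apply filterlim_locally; intros eps.
pose proof (cond_pos eps); pose proof PI2_1.
set (e := Rmin eps 1).
assert (He : 0 < e <= 1) by (split; [apply Rmin_pos; lra | apply Rmin_r]).
assert (Hc : cos e < 1) by (rewrite <- cos_0; apply cos_decreasing_1; lra).
exists (mkposreal (1 - cos e) ltac:(lra)); intros x Hx Hx1.
apply Rabs_lt_between' in Hx; simpl in Hx.
pose proof (COS_bound e); pose proof (acos_bound x).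
assert (acos x < e).
{ destruct (Rlt_le_dec (acos x) e) as [|Hge]; [assumption | exfalso].
  pose proof (cos_decr_1 e (acos x) ltac:(lra) ltac:(lra) ltac:(lra) ltac:(lra) Hge)
    as Hle.
  rewrite cos_acos in Hle; lra. }
assert (e <= eps) by apply Rmin_l.
apply Rabs_lt_between'; lra.
Qed.

Lemma filterlim_acos_at_right_m1 : filterlim acos (at_right (-1)) (locally PI).
Proof.
apply filterlim_locally; intros eps.
destruct (proj1 (filterlim_locally acos 0) filterlim_acos_at_left_1 eps) as [d Hd].
exists d; intros x Hx Hx1.
apply Rabs_lt_between' in Hx.
specialize (Hd (- x) ltac:(apply Rabs_lt_between'; lra) ltac:(lra)).
apply Rabs_lt_between' in Hd; rewrite acos_opp in Hd.
apply Rabs_lt_between'; lra.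
Qed.

Lemma is_derive_acos (x : R) :
  -1 < x < 1 -> is_derive acos x (-1 / sqrt (1 - x ^ 2)).
Proof.
intros Hx; apply is_derive_Reals.
replace (x ^ 2) with (Rsqr x) by (unfold Rsqr; ring).
rewrite <- (derive_pt_acos x Hx).
apply (derive_pt_eq_1 acos x _ (derivable_pt_acos x Hx)); reflexivity.
Qed.

(** The substitution [x = cos u]. With [P] a primitive of [Phi], [- P (acos x)] is a primitive of
    [g] on the open interval, and its limits at -1 and 1 are [- P PI] and [- P 0]. *)
Lemma integral_11_acos (g Phi : R -> R) :
  (forall u, continuous Phi u) ->
  (forall x, -1 < x < 1 -> g x = Phi (acos x) / sqrt (1 - x ^ 2)) ->
  integral_11 g = RInt Phi 0 PI.
Proof.
intros HPhi Hg.
set (P := (fun u => RInt Phi 0 u) : R -> R).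
assert (HP : forall u, is_derive P u (Phi u)).
{ intros u; apply (is_derive_RInt Phi P 0); [|apply HPhi].
  apply filter_forall; intros v; apply (RInt_correct Phi).
  now apply ex_RInt_of_continuous. }
assert (cP : forall u, continuous P u).
{ intros u; apply (ex_derive_continuous P); eexists; apply HP. }
set (f := fun x => - P (acos x)).
assert (Hf : forall x, -1 < x < 1 -> is_derive f x (g x)).
{ intros x Hx; rewrite Hg by exact Hx.
  replace (Phi (acos x) / sqrt (1 - x ^ 2))
    with (- (-1 / sqrt (1 - x ^ 2) * Phi (acos x))) by (unfold Rdiv; ring).
  apply (is_derive_opp (fun x => P (acos x))).
  apply (is_derive_comp P acos); [apply HP | now apply is_derive_acos]. }
assert (cg : forall x, -1 < x < 1 -> continuous (Derive f) x).
{ intros x Hx.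
  assert (Hloc : locally x (fun y => -1 < y < 1)).
  { apply filter_and; [now apply (open_gt (-1)) | now apply (open_lt 1)]. }
  apply (continuous_ext_loc _ (fun x => Phi (acos x) * / sqrt (1 - x ^ 2))).
  { revert Hloc; apply filter_imp; intros y Hy.
    rewrite (is_derive_unique f y (g y)) by now apply Hf.
    now rewrite Hg. }
  apply (continuous_mult (fun x => Phi (acos x)) (fun x => / sqrt (1 - x ^ 2))).
  - apply (continuous_comp acos Phi); [|apply HPhi].
    apply (ex_derive_continuous acos); eexists; now apply is_derive_acos.
  - apply (ex_derive_continuous (fun x => / sqrt (1 - x ^ 2))).
    assert (0 < 1 - x ^ 2) by nra.
    pose proof (sqrt_lt_R0 (1 - x ^ 2) ltac:(assumption)).
    auto_derive; simpl in *; repeat split; unfold Rminus in *; lra. }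
assert (Hin : forall Q : R -> Prop, (forall x, -1 < x < 1 -> Q x) ->
  filter_prod (at_right (-1)) (at_left 1) (fun ab =>
    forall x, Rmin (fst ab) (snd ab) <= x <= Rmax (fst ab) (snd ab) -> Q x)).
{ intros Q HQ.
  (* Separating the end points by 0 ensures [a < b], so that the interval is [[a, b]], inside the
     open interval. *)
  exists (fun a => -1 < a < 0) (fun b => 0 < b < 1).
  - exists (mkposreal 1 Rlt_0_1); intros y Hy Hy1.
    apply Rabs_lt_between' in Hy; simpl in Hy; lra.
  - exists (mkposreal 1 Rlt_0_1); intros y Hy Hy1.
    apply Rabs_lt_between' in Hy; simpl in Hy; lra.
  - intros a b Ha Hb x; simpl; rewrite Rmin_left, Rmax_right by lra.
    intros Hx; apply HQ; lra. }
apply is_RInt_gen_unique.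
apply (is_RInt_gen_ext (Derive f)).
{ eapply filter_imp; [|apply (Hin (fun x => Derive f x = g x))].
  - intros ab H x Hx; apply H; lra.
  - intros x Hx; now apply is_derive_unique, Hf. }
assert (E : P PI = - P 0 - - P PI).
{ assert (E0 : P 0 = 0) by (unfold P; now rewrite RInt_point).
  rewrite E0; ring. }
change (RInt Phi 0 PI) with (P PI); rewrite E.
apply (is_RInt_gen_Derive f (- P PI) (- P 0)).
- apply Hin; intros x Hx; eexists; now apply Hf.
- now apply Hin.
- apply (filterlim_comp _ _ _ acos (fun u => - P u) _ (locally PI)).
  + apply filterlim_acos_at_right_m1.
  + apply (continuous_opp P), cP.
- apply (filterlim_comp _ _ _ acos (fun u => - P u) _ (locally 0)).
  + apply filterlim_acos_at_left_1.
  + apply (continuous_opp P), cP.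
Qed.

Lemma weighted_integral_cos (g G : R -> R -> R) :
  (forall s t, continuity_2d_pt G s t) ->
  (forall s t, g (cos s) (cos t) = G s t) ->
  weighted_integral g = RInt (fun t => RInt (fun s => G s t) 0 PI) 0 PI.
Proof.
intros HG Hg; unfold weighted_integral; pose proof PI_RGT_0.
apply integral_11_acos.
{ intros t; apply continuous_RInt_param; [lra | exact HG]. }
intros y Hy.
assert (cG : forall s, continuous (fun s => G s (acos y)) s).
{ intros s; now apply continuous_slice_1. }
(* In the inner integral the weight in [y] is a constant factor; pulled out, it becomes the weight
   of the outer substitution. *)
rewrite (integral_11_acos _ (fun s => / sqrt (1 - y ^ 2) * G s (acos y))).
- rewrite (RInt_scal (fun s => G s (acos y))) by now apply ex_RInt_of_continuous.
  apply Rmult_comm.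
- intros s; now apply (continuous_scal_r _ (fun s => G s (acos y))).
- intros x Hx; rewrite <- Hg, !cos_acos by lra.
  unfold Rdiv; rewrite Rinv_mult; ring.
Qed.

(** Under the substitution [cheb k] becomes [cos (k s)]. The four cases of [cheb_coef] merge because
    [cos (0 * s) = 1] fills in the missing factors. *)
Lemma cheb_coef_cos (f : R -> R -> R) (k j : nat) :
  (forall s t, continuity_2d_pt (fun s t => f (cos s) (cos t)) s t) ->
  cheb_coef f k j
  = coef (fun t => coef (fun s => f (cos s) (cos t)) k) j.
Proof.
intros Hf; pose proof PI_RGT_0.
set (G := fun s t => f (cos s) (cos t) * cos (INR k * s) * cos (INR j * t)).
assert (HG : forall s t, continuity_2d_pt G s t).
{ intros s t; apply continuity_2d_pt_mult; [now apply continuity_2d_pt_mult_cos|].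
  apply (continuity_1d_2d_pt_comp (fun t => cos (INR j * t)) (fun _ t => t)).
  - apply continuity_pt_filterlim, continuous_cos_mult.
  - apply continuity_2d_pt_id2. }
transitivity (weight k * weight j / PI ^ 2 *
  RInt (fun t => RInt (fun s => G s t) 0 PI) 0 PI).
- unfold G in *; clear G.
  destruct k as [|k], j as [|j]; cbn [weight cheb_coef];
    (apply f_equal2; [field; lra|]);
    apply weighted_integral_cos; try exact HG; intros s t;
    rewrite ?cheb_cos; cbn [INR]; rewrite ?Rmult_0_l, ?cos_0; ring.
- unfold coef at 1.
  rewrite (RInt_ext (fun t => coef (fun s => f (cos s) (cos t)) k * cos (INR j * t))
    (fun t => weight k / PI * RInt (fun s => G s t) 0 PI)).
  + rewrite (RInt_scal (fun t => RInt (fun s => G s t) 0 PI)).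
    * unfold scal; simpl; unfold mult; simpl; field; lra.
    * apply ex_RInt_of_continuous; intros t.
      apply continuous_RInt_param; [lra | exact HG].
  + intros t _; unfold coef.
    rewrite Rmult_assoc; f_equal.
    rewrite Rmult_comm.
    rewrite <- (RInt_scal (V := R_CompleteNormedModule)
       (fun u => f (cos u) (cos t) * cos (INR k * u))).
    * apply RInt_ext; intros s _; unfold G, scal; simpl; unfold mult; simpl.
      real_ring.
    * apply ex_RInt_of_continuous; intros s.
      apply (continuous_slice_1
               (fun u t => f (cos u) (cos t) * cos (INR k * u)) s t).
      now apply continuity_2d_pt_mult_cos.
Qed.

Lemma cheb_approx_cos (f : R -> R -> R) (n m : nat) (s t : R) :
  (forall s t, continuity_2d_pt (fun s t => f (cos s) (cos t)) s t) ->
  cheb_approx f n m (cos s) (cos t)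
  = double_partial_sum n m (fun s t => f (cos s) (cos t)) s t.
Proof.
intros Hf; rewrite double_partial_sum_sum.
- apply sum_eq; intros k _; apply sum_eq; intros j _.
  now rewrite cheb_coef_cos, !cheb_cos.
- intros k u.
  now apply (continuous_coef_param (fun s t => f (cos s) (cos t))).
Qed.

(** * Regularity in the cosine variables *)

Lemma is_derive_comp_cos (g dg : R -> R) (s : R) :
  D_in g dg seg (cos s) ->
  is_derive (fun s => g (cos s)) s (- sin s * dg (cos s)).
Proof.
intros Hg; apply is_derive_Reals.
assert (Hcos : D_in cos (fun s => - sin s) no_cond s).
{ apply derivable_pt_lim_D_in, derivable_pt_lim_cos. }
(* The chain rule gives a derivative along the points [u] with [cos u] in [seg], which is the whole
   line. One-sided derivatives at -1 and 1 thus become two-sided. *)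
pose proof (Dcomp no_cond seg _ dg cos g s Hcos Hg) as H.
apply (derivable_pt_lim_D_in (fun s => g (cos s)) (fun s => - sin s * dg (cos s))).
intros eps Heps; destruct (H eps Heps) as [d [Hd H']].
exists d; split; [exact Hd|]; intros u [[_ Hu] Hd'].
apply H'; repeat split; auto; apply COS_bound.
Qed.

Lemma continuity_2d_pt_cos (h : R -> R -> R) (s t : R) :
  continuous_on_square h ->
  continuity_2d_pt (fun s t => h (cos s) (cos t)) s t.
Proof.
intros Hh eps.
assert (Hsq : forall u v, square (cos u, cos v)).
{ intros u v; split; apply COS_bound. }
destruct (proj1 (filterlim_locally _ _) (Hh (cos s, cos t) (Hsq s t)) eps)
  as [d Hd].
destruct (proj1 (continuity_pt_locally cos s) (continuity_cos s) d) as [d1 H1].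
destruct (proj1 (continuity_pt_locally cos t) (continuity_cos t) d) as [d2 H2].
exists (mkposreal _ (Rmin_stable_in_posreal d1 d2)); simpl; intros u v Hu Hv.
apply (Hd (cos u, cos v)); [|apply Hsq].
split; [apply H1 | apply H2].
- eapply Rlt_le_trans; [exact Hu | apply Rmin_l].
- eapply Rlt_le_trans; [exact Hv | apply Rmin_r].
Qed.

(** With [d] a modulus of uniform continuity for 1 on [[0, PI]^2], a chain of [k] steps of length at
    most [d / 2] in each variable leads from the origin to any point, and each step changes the
    value by less than 1. *)
Lemma bounded_of_continuity_2d (h : R -> R -> R) :
  (forall s t, continuity_2d_pt (fun s t => h (cos s) (cos t)) s t) ->
  exists M, forall s t, Rabs (h (cos s) (cos t)) <= M.
Proof.
intros Hh; pose proof PI_RGT_0.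
destruct (uniform_continuity_2d (fun s t => h (cos s) (cos t)) 0 PI 0 PI
  (fun s t _ _ => Hh s t) (mkposreal 1 Rlt_0_1)) as [d Hd]; simpl in Hd.
pose proof (cond_pos d).
assert (Hstep : forall k s t, 0 <= s <= PI -> 0 <= t <= PI ->
   s <= INR k * (d / 2) -> t <= INR k * (d / 2) ->
   Rabs (h (cos s) (cos t)) <= Rabs (h (cos 0) (cos 0)) + INR k).
{ induction k as [|k IH]; intros s t Hs Ht Hsk Htk.
  - simpl in *; replace s with 0 by lra; replace t with 0 by lra; lra.
  - rewrite S_INR in *.
    assert (Hprev : forall x, 0 <= x <= PI -> x <= (INR k + 1) * (d / 2) ->
      exists y, 0 <= y <= PI /\ y <= INR k * (d / 2) /\ Rabs (x - y) < d).
    { intros x Hx Hxk; exists (Rmax 0 (x - d / 2)).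
      pose proof (pos_INR k).
      unfold Rmax; destruct (Rle_dec 0 (x - d / 2));
        (split; [lra | split; [nra | apply Rabs_lt_between; lra]]). }
    destruct (Hprev s Hs Hsk) as [s' [Hs' [Hsk' Hds]]].
    destruct (Hprev t Ht Htk) as [t' [Ht' [Htk' Hdt]]].
    pose proof (IH s' t' Hs' Ht' Hsk' Htk').
    pose proof (Hd s' t' s t Hs' Ht' Hs Ht Hds Hdt) as Hlt.
    pose proof (Rabs_triang_inv (h (cos s) (cos t)) (h (cos s') (cos t'))).
    lra. }
destruct (INR_archimed (d / 2) PI ltac:(lra)) as [k Hk].
exists (Rabs (h (cos 0) (cos 0)) + INR k); intros s t.
(* Any real [s] may be replaced by [acos (cos s)], which lies in [[0, PI]]. *)
rewrite <- (cos_acos (cos s)), <- (cos_acos (cos t)) by apply COS_bound.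
pose proof (acos_bound (cos s)); pose proof (acos_bound (cos t)).
apply Hstep; lra.
Qed.

Lemma lipschitz_of_derive (g dg : R -> R) (M a b : R) :
  (forall u, is_derive g u (dg u)) -> (forall u, Rabs (dg u) <= M) ->
  Rabs (g b - g a) <= M * Rabs (b - a).
Proof.
intros Hg HM.
destruct (MVT_gen g a b dg) as [c [_ ->]].
- intros; apply Hg.
- intros x _; apply continuity_pt_filterlim, (ex_derive_continuous g).
  eexists; apply Hg.
- rewrite Rabs_mult; apply Rmult_le_compat_r; [apply Rabs_pos | apply HM].
Qed.

Lemma Rabs_trig_mult_le (a x M : R) :
  -1 <= a <= 1 -> Rabs x <= M -> Rabs (a * x) <= M.
Proof.
intros Ha Hx; rewrite Rabs_mult.
assert (Rabs a <= 1) by (apply Rabs_le; lra).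
pose proof (Rabs_pos a); pose proof (Rabs_pos x); nra.
Qed.

(** Bounded partial derivatives make the function Lipschitz in each variable; joint continuity
    follows along the path from [(u, v)] through [(s, v)] to [(s, t)]. It serves to descend from
    second to first partial derivatives, and from these to [f]. *)
Lemma continuity_2d_pt_of_partials (h hx hy : R -> R -> R) :
  is_partial_x h hx -> is_partial_y h hy ->
  (forall s t, continuity_2d_pt (fun s t => hx (cos s) (cos t)) s t) ->
  (forall s t, continuity_2d_pt (fun s t => hy (cos s) (cos t)) s t) ->
  forall s t, continuity_2d_pt (fun s t => h (cos s) (cos t)) s t.
Proof.
intros Hx Hy cx cy s t eps.
destruct (bounded_of_continuity_2d hx cx) as [Mx HMx].
destruct (bounded_of_continuity_2d hy cy) as [My HMy].
pose proof (Rle_trans _ _ _ (Rabs_pos _) (HMx 0 0)).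
pose proof (Rle_trans _ _ _ (Rabs_pos _) (HMy 0 0)).
pose proof (cond_pos eps).
assert (Hd : 0 < eps / (Mx + My + 1)) by (apply Rdiv_lt_0_compat; lra).
exists (mkposreal _ Hd); simpl; intros u v Hu Hv.
assert (E1 : Rabs (h (cos u) (cos v) - h (cos s) (cos v)) <= Mx * Rabs (u - s)).
{ apply (lipschitz_of_derive (fun s => h (cos s) (cos v))
           (fun s => - sin s * hx (cos s) (cos v))).
  - intros w; apply (is_derive_comp_cos (fun x => h x (cos v))
                       (fun x => hx x (cos v))).
    apply Hx; apply COS_bound.
  - intros w; apply Rabs_trig_mult_le; [|apply HMx].
    pose proof (SIN_bound w); lra. }
assert (E2 : Rabs (h (cos s) (cos v) - h (cos s) (cos t)) <= My * Rabs (v - t)).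
{ apply (lipschitz_of_derive (fun t => h (cos s) (cos t))
           (fun t => - sin t * hy (cos s) (cos t))).
  - intros w; apply (is_derive_comp_cos (h (cos s)) (hy (cos s))).
    apply Hy; apply COS_bound.
  - intros w; apply Rabs_trig_mult_le; [|apply HMy].
    pose proof (SIN_bound w); lra. }
replace (h (cos u) (cos v) - h (cos s) (cos t)) with
  ((h (cos u) (cos v) - h (cos s) (cos v)) + (h (cos s) (cos v) - h (cos s) (cos t)))
  by ring.
eapply Rle_lt_trans; [apply Rabs_triang|].
set (r := eps / (Mx + My + 1)) in *.
assert (r * (Mx + My + 1) = eps) by (unfold r; field; lra).
nra.
Qed.

(** * Uniform convergence on the square *)

Lemma rate_vanishes (d : R) :
  0 < d -> exists N : nat, forall n : nat, (N <= n)%nat ->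
    816 / sqrt (INR n + 1) <= d.
Proof.
intros Hd.
destruct (INR_archimed 1 ((816 / d) ^ 2) ltac:(lra)) as [N HN].
exists N; intros n Hn; apply le_INR in Hn.
assert (H0 : 0 < 816 / d) by (apply Rdiv_lt_0_compat; lra).
assert (Hs : 816 / d <= sqrt (INR n + 1)).
{ rewrite <- (sqrt_pow2 (816 / d)) by lra; apply sqrt_le_1_alt; lra. }
apply Rle_div_l; [lra|].
apply (Rmult_le_compat_l d) in Hs; [|lra].
replace (d * (816 / d)) with 816 in Hs by (field; lra); lra.
Qed.

Theorem theorem6p2 (f : R -> R -> R)
  (hf : continuous_second_partials f) :
  forall eps : R, 0 < eps ->
    exists N : nat, forall n m : nat, (N <= n)%nat -> (N <= m)%nat ->
      forall x y : R, -1 <= x <= 1 -> -1 <= y <= 1 ->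
        Rabs (f x y - cheb_approx f n m x y) < eps.
Proof.
destruct hf as (fx & fy & fxx & fxy & fyx & fyy & Hfx & Hfy & Hfxx & Hfxy
                & Hfyx & Hfyy & cxx & cxy & cyx & cyy).
assert (cfx : forall s t, continuity_2d_pt (fun s t => fx (cos s) (cos t)) s t).
{ apply (continuity_2d_pt_of_partials fx fxx fxy); auto using continuity_2d_pt_cos. }
assert (cfy : forall s t, continuity_2d_pt (fun s t => fy (cos s) (cos t)) s t).
{ apply (continuity_2d_pt_of_partials fy fyx fyy); auto using continuity_2d_pt_cos. }
assert (cf : forall s t, continuity_2d_pt (fun s t => f (cos s) (cos t)) s t).
{ now apply (continuity_2d_pt_of_partials f fx fy). }
assert (cfyx : forall s t, continuity_2d_pt (fun s t => fyx (cos s) (cos t)) s t).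
{ intros; now apply continuity_2d_pt_cos. }
destruct (bounded_of_continuity_2d fx cfx) as [M1 B1].
destruct (bounded_of_continuity_2d fy cfy) as [M2 B2].
destruct (bounded_of_continuity_2d fyx cfyx) as [M3 B3].
pose proof (Rle_trans _ _ _ (Rabs_pos _) (B1 0 0)).
pose proof (Rle_trans _ _ _ (Rabs_pos _) (B2 0 0)).
pose proof (Rle_trans _ _ _ (Rabs_pos _) (B3 0 0)).
set (M := M1 + M2 + M3).
assert (Hsin : forall s, -1 <= - sin s <= 1).
{ intros s; pose proof (SIN_bound s); lra. }
assert (csin : forall u, continuity_pt (fun u => - sin u) u).
{ intros u; apply continuity_pt_filterlim, (ex_derive_continuous (fun u => - sin u)).
  auto_derive; exact I. }
assert (Herr : forall n m s t, 0 <= s <= PI -> 0 <= t <= PI ->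
  Rabs (f (cos s) (cos t) - cheb_approx f n m (cos s) (cos t))
  <= M * (816 / sqrt (INR n + 1))
     + (M + M * (816 / sqrt (INR n + 1))) * (816 / sqrt (INR m + 1))).
{ intros n m s t Hs Ht; rewrite cheb_approx_cos by exact cf.
  (* The chain rule gives [F_s], [F_t] and [F_ts] for [F(s,t) = f(cos s, cos t)]; the sine factors
     are at most 1 in absolute value, so [M] bounds all three. *)
  apply (double_partial_sum_error n m (fun s t => f (cos s) (cos t))
    (fun s t => - sin s * fx (cos s) (cos t))
    (fun s t => - sin t * fy (cos s) (cos t))
    (fun s t => - sin t * (- sin s * fyx (cos s) (cos t)))); try assumption;
  clear s t Hs Ht; intros s t.
  - apply (is_derive_comp_cos (fun x => f x (cos t)) (fun x => fx x (cos t))).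
    apply Hfx; apply COS_bound.
  - apply (is_derive_comp_cos (f (cos s)) (fy (cos s))).
    apply Hfy; apply COS_bound.
  - apply (is_derive_scal (fun s => fy (cos s) (cos t))).
    apply (is_derive_comp_cos (fun x => fy x (cos t)) (fun x => fyx x (cos t))).
    apply Hfyx; apply COS_bound.
  - apply (continuous_slice_1 (fun s t => - sin s * fx (cos s) (cos t))).
    apply continuity_2d_pt_mult; [|apply cfx].
    apply (continuity_1d_2d_pt_comp (fun u => - sin u) (fun s _ => s));
      [apply csin | apply continuity_2d_pt_id1].
  - apply continuity_2d_pt_mult; [|apply cfy].
    apply (continuity_1d_2d_pt_comp (fun u => - sin u) (fun _ t => t));
      [apply csin | apply continuity_2d_pt_id2].
  - apply (continuous_scal_r (- sin t) (fun s => - sin s * fyx (cos s) (cos t))).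
    apply (continuous_slice_1 (fun s t => - sin s * fyx (cos s) (cos t))).
    apply continuity_2d_pt_mult; [|apply cfyx].
    apply (continuity_1d_2d_pt_comp (fun u => - sin u) (fun s _ => s));
      [apply csin | apply continuity_2d_pt_id1].
  - apply Rabs_trig_mult_le; [apply Hsin|]; specialize (B1 s t); unfold M; lra.
  - apply Rabs_trig_mult_le; [apply Hsin|]; specialize (B2 s t); unfold M; lra.
  - do 2 (apply Rabs_trig_mult_le; [apply Hsin|]).
    specialize (B3 s t); unfold M; lra. }
assert (HM : 0 <= M) by (unfold M; lra).
intros eps Heps.
(* If both rates are at most [d <= 1], the error is at most [M d + (M + M) d = 3 M d], which is
   strictly below [d (3 M + 1) <= eps]. *)
set (d := Rmin 1 (eps / (3 * M + 1))).
assert (Hd : 0 < d) by (apply Rmin_pos; [lra | apply Rdiv_lt_0_compat; lra]).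
assert (Hd1 : d <= 1) by apply Rmin_l.
assert (Hd2 : d * (3 * M + 1) <= eps).
{ apply Rle_div_r; [lra | apply Rmin_r]. }
destruct (rate_vanishes d Hd) as [N HN].
exists N; intros n m Hn Hm x y Hx Hy.
rewrite <- (cos_acos x), <- (cos_acos y) by assumption.
eapply Rle_lt_trans; [apply Herr; apply acos_bound|].
specialize (HN n Hn) as Hen; specialize (HN m Hm) as Hem.
set (en := 816 / sqrt (INR n + 1)) in *.
set (em := 816 / sqrt (INR m + 1)) in *.
assert (M * en <= M * d) by (apply Rmult_le_compat_l; lra).
assert (M * d <= M) by nra.
assert ((M + M * en) * em <= (M + M * en) * d).
{ apply Rmult_le_compat_l; [|exact Hem].
  assert (0 <= en); [|nra].
  apply Rlt_le, Rdiv_lt_0_compat; [lra | apply sqrt_lt_R0].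
  pose proof (pos_INR n); lra. }
nra.
Qed.
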